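(* Let $p$ be a prime, $n\ge 0$, and suppose $k$ is a clarified $C_{p^n}$-Tambara functor of characteristic $p$. Let $\phi$ denote the Frobenius endomorphism $x\mapsto x^p$. Then for each $0\le s\le n$, the ring $k(C_{p^n}/C_{p^s})$, viewed as a subring of the field $k(C_{p^n}/e)$ via the restriction map, is an intermediate field of the extension $$\phi^n\left(k(C_{p^n}/e)^{C_{p^n}}\right) \hookrightarrow k(C_{p^n}/e).$$
   Context: For a finite group $G$, a $G$-Tambara functor $k$ assigns to each finite $G$-set $X$ a commutative ring $k(X)$ (taking disjoint unions to products) and to each map $X \to Y$ of finite $G$-sets a restriction $k(Y)\to k(X)$ (a ring map), an additive transfer $k(X)\to k(Y)$ and a multiplicative norm $k(X)\to k(Y)$, satisfying the standard axioms (as in Tambara, Strickland). The group $G$ acts on $k(G/e)$. A nonzero $G$-Tambara functor $k$ is field-like if every morphism $k \to \ell$ with $\ell \neq 0$ is monic. (Nakaoka: equivalently, all restriction maps of $k$ are injective and $k(G/e)$ is nonzero with no nontrivial $G$-invariant ideals.) For $H\subset G$ and an $H$-ring $R$ (a commutative ring with $H$-action), $\mathrm{Coind}_H^G R=\mathrm{Fun}(G/H,R)$ is the coinduced $G$-ring (value of the right adjoint to restriction of rings with action). A field-like $k$ is separated if $k(G/e) \cong \mathrm{Coind}_H^G R$ as $G$-rings for some proper subgroup $H$ and $H$-ring $R$; otherwise it is clarified (so clarified functors are field-like). Equivalently, a field-like $k$ is clarified iff $k(G/e)$ is a field. The characteristic of a field-like $k$ is the characteristic of $k(G/e)$. *)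

(* Defs.v *)
From HB Require Import structures.
From mathcomp Require Import all_boot all_order all_algebra all_fingroup all_solvable.
Set Implicit Arguments.
Unset Strict Implicit.
Unset Printing Implicit Defensive.
Import GRing.Theory.
Local Open Scope ring_scope.

(* Conventions.  MathComp actions are right actions, so G-sets and G-rings are
   right ones throughout; x.g := g^-1.x translates to left actions, and turns
   the left coset space G/H into the space of right cosets H :* x.  The group G
   is the whole finGroupType gT. *)

Record gset (gT : finGroupType) := GSet {
  gset_sort :> finType;
  gact : {action gT &-> gset_sort}
}.
Arguments gact {gT} X : rename.

Record gmap (gT : finGroupType) (X Y : gset gT) := GMap {
  gmap_fun :> X -> Y;
  gmapP : forall x g, gmap_fun (gact X x g) = gact Y (gmap_fun x) g
}.

Lemma gsum_act1 (gT : finGroupType) (X Y : gset gT) :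
  (fun (z : X + Y) g => match z with
     | inl x => inl (gact X x g) | inr y => inr (gact Y y g) end)^~ 1%g =1 id.
Proof. by case=> z; rewrite act1. Qed.

Lemma gsum_actM (gT : finGroupType) (X Y : gset gT) (z : X + Y) :
  act_morph (fun (z : X + Y) g => match z with
     | inl x => inl (gact X x g) | inr y => inr (gact Y y g) end) z.
Proof. by case: z => z a b; rewrite actM. Qed.

Definition gsum (gT : finGroupType) (X Y : gset gT) : gset gT :=
  GSet (TotalAction (@gsum_act1 gT X Y) (@gsum_actM gT X Y)).

Definition ginl (gT : finGroupType) (X Y : gset gT) : gmap X (gsum X Y) :=
  @GMap gT X (gsum X Y) inl (fun _ _ => erefl).

Definition ginr (gT : finGroupType) (X Y : gset gT) : gmap Y (gsum X Y) :=
  @GMap gT Y (gsum X Y) inr (fun _ _ => erefl).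

Lemma gempty_act1 (gT : finGroupType) :
  (fun (z : void) (_ : gT) => z)^~ 1%g =1 id.
Proof. by []. Qed.

Lemma gempty_actM (gT : finGroupType) (z : void) :
  act_morph (fun (z : void) (_ : gT) => z) z.
Proof. by []. Qed.

Definition gempty (gT : finGroupType) : gset gT :=
  GSet (TotalAction (@gempty_act1 gT) (@gempty_actM gT)).

(* G/e, as G acting on itself by translation. *)
Definition gfree (gT : finGroupType) : gset gT := @GSet gT gT 'R%act.

(* Translation on the other side: the automorphisms of the G-set G/e. *)
Definition gtrans (gT : finGroupType) (g : gT) : gmap (gfree gT) (gfree gT) :=
  @GMap gT (gfree gT) (gfree gT) (fun x => g * x)%g (mulgA g).

Definition coset_space (gT : finGroupType) (H : {group gT}) : finType :=
  {A : {set gT} | A \in rcosets H [set: gT]}.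

Lemma coset_act_subproof (gT : finGroupType) (H : {group gT})
    (A : coset_space H) (g : gT) : (val A :* g)%g \in rcosets H [set: gT].
Proof.
case: A => A /= /rcosetsP[x _ ->]; rewrite -rcosetM.
by apply/rcosetsP; exists (x * g)%g; rewrite ?inE.
Qed.

Definition coset_act (gT : finGroupType) (H : {group gT})
    (A : coset_space H) (g : gT) : coset_space H :=
  exist _ (val A :* g)%g (coset_act_subproof A g).

Lemma coset_act1 (gT : finGroupType) (H : {group gT}) :
  (@coset_act gT H)^~ 1%g =1 id.
Proof. by move=> A; apply: val_inj; rewrite /= rcoset1. Qed.

Lemma coset_actM (gT : finGroupType) (H : {group gT}) (A : coset_space H) :
  act_morph (@coset_act gT H) A.
Proof. by move=> a b; apply: val_inj; rewrite /= rcosetM. Qed.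

Definition gcosets (gT : finGroupType) (H : {group gT}) : gset gT :=
  GSet (TotalAction (@coset_act1 gT H) (@coset_actM gT H)).

Lemma gproj_subproof (gT : finGroupType) (H : {group gT}) (x : gT) :
  (H :* x)%g \in rcosets H [set: gT].
Proof. by apply/rcosetsP; exists x; rewrite ?inE. Qed.

Lemma gproj_equivariant (gT : finGroupType) (H : {group gT}) (x g : gT) :
  exist _ (H :* (x * g))%g (gproj_subproof H (x * g)) =
  coset_act (exist _ (H :* x)%g (gproj_subproof H x)) g :> coset_space H.
Proof. by apply: val_inj; rewrite /= rcosetM. Qed.

Definition gproj (gT : finGroupType) (H : {group gT}) :
    gmap (gfree gT) (gcosets H) :=
  @GMap gT (gfree gT) (gcosets H)
    (fun x => exist _ (H :* x)%g (gproj_subproof H x)) (gproj_equivariant H).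

(* The square with sides fst : W -> X, snd : W -> Z, f : X -> Y, g : Z -> Y
   exhibits W as the fibre product of X and Z over Y. *)
Definition pullback_square (gT : finGroupType) (X Y Z W : gset gT)
    (f : gmap X Y) (g : gmap Z Y) (fst : gmap W X) (snd : gmap W Z) : Prop :=
  (forall w, f (fst w) = g (snd w)) /\
  (forall x z, f x = g z -> exists! w, fst w = x /\ snd w = z).

(* X <-p- A <-e- W -f'-> P -q-> Y is an exponential diagram over f : X -> Y:
   W = X x_Y P, and b |-> (q b, e(-, b)) identifies P with Pi_f A, the set of
   pairs of a point y of Y and a section s of p over the fibre of f at y.
   Sections take a proof of f x = y since A may be empty when a fibre is. *)
Definition exponential_diagram (gT : finGroupType) (X Y A P W : gset gT)
    (f : gmap X Y) (p : gmap A X) (q : gmap P Y)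
    (r : gmap W X) (f' : gmap W P) (e : gmap W A) : Prop :=
  [/\ pullback_square f q r f',
      forall w, p (e w) = r w
    & forall (y : Y) (s : forall x : X, f x = y -> A),
        (forall x (xy : f x = y), p (s x xy) = x) ->
        exists! b : P, q b = y /\
          forall w (wy : f (r w) = y), f' w = b -> e w = s (r w) wy].

(* Values may be the zero ring, hence comPzRingType.  Functoriality is stated
   up to pointwise equality of maps of G-sets. *)
Record tambara (gT : finGroupType) := Tambara {
  tval :> gset gT -> comPzRingType;
  res : forall X Y : gset gT, gmap X Y -> {rmorphism tval Y -> tval X};
  tr : forall X Y : gset gT, gmap X Y -> {additive tval X -> tval Y};
  nm : forall X Y : gset gT, gmap X Y -> tval X -> tval Y;
  nm_monoid : forall (X Y : gset gT) (f : gmap X Y), monoid_morphism (nm f);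
  res_id : forall (X : gset gT) (f : gmap X X), f =1 id -> res f =1 id;
  tr_id : forall (X : gset gT) (f : gmap X X), f =1 id -> tr f =1 id;
  nm_id : forall (X : gset gT) (f : gmap X X), f =1 id -> nm f =1 id;
  res_comp : forall (X Y Z : gset gT)
    (f : gmap X Y) (g : gmap Y Z) (h : gmap X Z),
    h =1 g \o f -> res h =1 res f \o res g;
  tr_comp : forall (X Y Z : gset gT)
    (f : gmap X Y) (g : gmap Y Z) (h : gmap X Z),
    h =1 g \o f -> tr h =1 tr g \o tr f;
  nm_comp : forall (X Y Z : gset gT)
    (f : gmap X Y) (g : gmap Y Z) (h : gmap X Z),
    h =1 g \o f -> nm h =1 nm g \o nm f;
  tval_empty : forall a : tval (gempty gT), a = 0;
  tval_sum : forall X Y : gset gT,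
    bijective (fun a : tval (gsum X Y) => (res (ginl X Y) a, res (ginr X Y) a));
  tr_pullback : forall (X Y Z W : gset gT)
    (f : gmap X Y) (g : gmap Z Y) (fst : gmap W X) (snd : gmap W Z),
    pullback_square f g fst snd -> res g \o tr f =1 tr snd \o res fst;
  nm_pullback : forall (X Y Z W : gset gT)
    (f : gmap X Y) (g : gmap Z Y) (fst : gmap W X) (snd : gmap W Z),
    pullback_square f g fst snd -> res g \o nm f =1 nm snd \o res fst;
  nm_tr : forall (X Y A P W : gset gT) (f : gmap X Y) (p : gmap A X)
    (q : gmap P Y) (r : gmap W X) (f' : gmap W P) (e : gmap W A),
    exponential_diagram f p q r f' e ->
    nm f \o tr p =1 tr q \o nm f' \o res e
}.
Arguments res {gT} k {X Y} f : rename.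
Arguments tr {gT} k {X Y} f : rename.
Arguments nm {gT} k {X Y} f _ : rename.

Record tmorphism (gT : finGroupType) (k l : tambara gT) := TMorphism {
  tmor :> forall X : gset gT, {rmorphism k X -> l X};
  tmor_res : forall (X Y : gset gT) (f : gmap X Y),
    tmor X \o res k f =1 res l f \o tmor Y;
  tmor_tr : forall (X Y : gset gT) (f : gmap X Y),
    tmor Y \o tr k f =1 tr l f \o tmor X;
  tmor_nm : forall (X Y : gset gT) (f : gmap X Y),
    tmor Y \o nm k f =1 nm l f \o tmor X
}.

Definition tmonic (gT : finGroupType) (k l : tambara gT)
    (F : tmorphism k l) : Prop :=
  forall (m : tambara gT) (u v : tmorphism m k),
    (forall X, F X \o u X =1 F X \o v X) -> forall X, u X =1 v X.

Definition nonzero (gT : finGroupType) (k : tambara gT) : Prop :=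
  exists X : gset gT, 1 != 0 :> k X.

Definition field_like (gT : finGroupType) (k : tambara gT) : Prop :=
  nonzero k /\
  forall (l : tambara gT) (F : tmorphism k l), nonzero l -> tmonic F.

Record gring (gT : finGroupType) := GRingWithAction {
  gring_sort :> comPzRingType;
  gring_act : {action gT &-> gring_sort};
  gring_actB : forall g, zmod_morphism (gring_act^~ g);
  gring_actM : forall g, monoid_morphism (gring_act^~ g)
}.
Arguments gring_act {gT} R : rename.
Arguments gring_actB {gT} R g : rename.
Arguments gring_actM {gT} R g : rename.

Definition gring_iso (gT : finGroupType) (R S : gring gT) : Prop :=
  exists f : {rmorphism R -> S},
    bijective f /\ forall x g, f (gring_act R x g) = gring_act S (f x) g.

(* An H-ring is a gring over [subg H], the group H seen as a type.  Coind R is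
   the ring of H-equivariant functions f : G -> R, with (f.g)(x) = f (g x);
   evaluation at 1 is the counit of the adjunction with restriction. *)
Definition coind_pred (gT : finGroupType) (H : {group gT})
    (R : gring (subg_of H)) : {pred {ffun gT -> R}} :=
  fun f => [forall x, forall h : subg_of H,
              f (x * sgval h)%g == gring_act R (f x) h].
Arguments coind_pred {gT H} R.

Record coind (gT : finGroupType) (H : {group gT}) (R : gring (subg_of H)) :=
  Coind { coind_val : {ffun gT -> R}; _ : coind_val \in coind_pred R }.

HB.instance Definition _ (gT : finGroupType) (H : {group gT})
  (R : gring (subg_of H)) := [isSub for @coind_val gT H R].
HB.instance Definition _ (gT : finGroupType) (H : {group gT})
  (R : gring (subg_of H)) := [Choice of coind R by <:].

Lemma coind_predP (gT : finGroupType) (H : {group gT}) (R : gring (subg_of H))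
    (f : {ffun gT -> R}) :
  reflect (forall x (h : subg_of H), f (x * sgval h)%g = gring_act R (f x) h)
          (f \in coind_pred R).
Proof.
by apply: (iffP forallP) => [Pf x h|Pf x]; [apply/eqP; move/forallP: (Pf x) |
  apply/forallP=> h; apply/eqP].
Qed.

Lemma coind_subring_closed (gT : finGroupType) (H : {group gT})
    (R : gring (subg_of H)) : subring_closed (coind_pred R).
Proof.
split=> [|f1 f2 /coind_predP P1 /coind_predP P2|
          f1 f2 /coind_predP P1 /coind_predP P2]; apply/coind_predP => x h.
- by rewrite !ffunE (gring_actM R h).1.
- by rewrite !ffunE P1 P2 -(gring_actB R h).
- by rewrite !ffunE P1 P2 -(gring_actM R h).2.
Qed.

HB.instance Definition _ (gT : finGroupType) (H : {group gT})
  (R : gring (subg_of H)) :=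
  GRing.isSubringClosed.Build _ (coind_pred R) (@coind_subring_closed gT H R).
HB.instance Definition _ (gT : finGroupType) (H : {group gT})
  (R : gring (subg_of H)) :=
  GRing.SubChoice_isSubPzRing.Build _ _ (coind R) (@coind_subring_closed gT H R).

Lemma coind_mulC (gT : finGroupType) (H : {group gT}) (R : gring (subg_of H)) :
  commutative (@GRing.mul (coind R)).
Proof.
by move=> f g; apply: val_inj; apply/ffunP=> x; rewrite !ffunE mulrC.
Qed.

HB.instance Definition _ (gT : finGroupType) (H : {group gT})
  (R : gring (subg_of H)) :=
  GRing.PzRing_hasCommutativeMul.Build (coind R) (@coind_mulC gT H R).

Lemma coind_act_subproof (gT : finGroupType) (H : {group gT})
    (R : gring (subg_of H)) (f : coind R) (g : gT) :
  [ffun x => coind_val f (g * x)%g] \in coind_pred R.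
Proof.
case: f => f Pf; apply/coind_predP => x h; rewrite !ffunE /= mulgA.
by move/coind_predP: Pf => ->.
Qed.

Definition coind_act (gT : finGroupType) (H : {group gT})
    (R : gring (subg_of H)) (f : coind R) (g : gT) : coind R :=
  Coind (coind_act_subproof f g).

Lemma coind_act1 (gT : finGroupType) (H : {group gT}) (R : gring (subg_of H)) :
  (@coind_act gT H R)^~ 1%g =1 id.
Proof.
by move=> f; apply: val_inj; apply/ffunP=> x; rewrite !ffunE mul1g.
Qed.

Lemma coind_actMg (gT : finGroupType) (H : {group gT}) (R : gring (subg_of H))
  (f : coind R) : act_morph (@coind_act gT H R) f.
Proof.
by move=> a b; apply: val_inj; apply/ffunP=> x; rewrite !ffunE mulgA.
Qed.

Lemma coind_actB (gT : finGroupType) (H : {group gT}) (R : gring (subg_of H))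
  g : zmod_morphism ((@coind_act gT H R)^~ g).
Proof.
by move=> f1 f2; apply: val_inj; apply/ffunP=> x; rewrite !ffunE.
Qed.

Lemma coind_actM (gT : finGroupType) (H : {group gT}) (R : gring (subg_of H))
  g : monoid_morphism ((@coind_act gT H R)^~ g).
Proof.
by split=> [|f1 f2]; apply: val_inj; apply/ffunP=> x; rewrite !ffunE.
Qed.

Definition coind_gring (gT : finGroupType) (H : {group gT})
    (R : gring (subg_of H)) : gring gT :=
  @GRingWithAction gT (coind R)
    (TotalAction (@coind_act1 gT H R) (@coind_actMg gT H R))
    (@coind_actB gT H R) (@coind_actM gT H R).

Lemma bottom_act1 (gT : finGroupType) (k : tambara gT) :
  (fun (a : k (gfree gT)) g => res k (gtrans g) a)^~ 1%g =1 id.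
Proof. by apply: res_id => x; exact: mul1g. Qed.

Lemma bottom_actMg (gT : finGroupType) (k : tambara gT) (a : k (gfree gT)) :
  act_morph (fun (a : k (gfree gT)) g => res k (gtrans g) a) a.
Proof. by move=> g h; apply: res_comp => x; rewrite /= mulgA. Qed.

(* The G-ring k(G/e). *)
Definition bottom (gT : finGroupType) (k : tambara gT) : gring gT :=
  @GRingWithAction gT (k (gfree gT))
    (TotalAction (@bottom_act1 gT k) (@bottom_actMg gT k))
    (fun g => raddfB (res k (gtrans g)))
    (fun g => (rmorph1 (res k (gtrans g)), rmorphM (res k (gtrans g)))).

Definition separated (gT : finGroupType) (k : tambara gT) : Prop :=
  exists (H : {group gT}) (R : gring (subg_of H)),
    H \proper [set: gT] /\ gring_iso (bottom k) (coind_gring R).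

Definition clarified (gT : finGroupType) (k : tambara gT) : Prop :=
  field_like k /\ ~ separated k.

(* [pchar R] is only available for nonzero rings. *)
Definition has_char (R : comPzRingType) (c : nat) : Prop :=
  forall m : nat, m%:R = 0 :> R <-> (c %| m)%N.

Definition is_field (K : comPzRingType) : Prop :=
  1 != 0 :> K /\ forall x : K, x != 0 -> exists y, x * y = 1.

Definition is_subfield (K : comPzRingType) (E : K -> Prop) : Prop :=
  [/\ E 1,
      forall x y, E x -> E y -> E (x - y),
      forall x y, E x -> E y -> E (x * y)
    & forall x, E x -> x != 0 -> exists2 y, E y & x * y = 1].

Definition intermediate_field (K : comPzRingType) (F E : K -> Prop) : Prop :=
  [/\ is_subfield F, is_subfield E & forall x, F x -> E x].

Definition frobenius (K : comPzRingType) (p : nat) (x : K) : K := x ^+ p.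

Definition ginvariant (gT : finGroupType) (R : gring gT) (x : R) : Prop :=
  forall g, gring_act R x g = x.

(* Main.v *)
From HB Require Import structures.
From mathcomp Require Import all_boot all_order all_algebra all_fingroup all_solvable.
From mathcomp.classical Require Import boolp.
Require Import Defs.
Set Implicit Arguments.
Unset Strict Implicit.
Unset Printing Implicit Defensive.
Import GRing.Theory.
Local Open Scope ring_scope.
Local Open Scope quotient_scope.

(** Write G for C_{p^n} and K for the G-ring k(G/e).  Two constructions test
    whether k is field-like.  A G-ring S has a fixed-point functor FP(S), whose
    value at X is the ring of G-maps X -> S, with restriction, transfer and norm
    given by composition and by sums and products over fibres; and an
    equivariant ring map phi : K -> S extends to a morphism k -> FP(S) that
    sends a to the function x |-> phi(res_x a), where res_x restricts along the
    G-map G/e -> X through x ([fixed_morphism]; compatibility with transfers and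
    norms is the double coset formula [res_gpoint_tr], [res_gpoint_nm]).  A
    monic morphism is injective at every level, because the projections of its
    kernel pair agree ([tmonic_inj]).  So, k being field-like, every phi with
    nonzero target is injective, and the case phi = id shows that the
    restrictions k(G/H) -> K are injective.

    Applied to K -> K/aK, this makes every nonzero G-invariant a invertible
    ([field_like_invariant_unit]); applied to the Frobenius of K, it makes K
    reduced ([field_like_reduced]).  A G-ring with these two properties is a
    field or is coinduced from a proper subgroup ([field_or_coind]): for a
    nonzero nonunit x, take a largest nonempty set S of group elements for which
    y, the product of the x.g with g in S, is nonzero.  Distinct translates of y
    multiply to zero, and dividing y by the invariant sum of its translates
    gives an idempotent that splits K into a product indexed by G modulo the
    stabiliser of S.  As k is clarified, K is a field.

    Finally, composing the norm and the restriction between K and k(G/H) sends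
    an H-invariant element a to a^|H| ([res_nm_gproj]).  With |H| = p^s and
    a = b^(p^(n-s)) for b invariant under G, this puts b^(p^n), the n-th
    Frobenius iterate of b, in the image of k(G/H).  And if x in that image is
    nonzero, its inverse y is H-invariant, so y = x^(|H|-1) y^|H| is in the
    image too. *)

(** * Big operators along a map *)

Section BigFibre.
Variables (R : Type) (idx : R) (op : Monoid.com_law idx) (I J : finType).
(** Fibre products and exponential diagrams are given by unique existence, so
    change of variables is needed in this form, where [h] is a bijection from
    [P] to [Q] but has no inverse defined on all of [J]. *)
Lemma big_unique_preim (h : I -> J) (P : pred I) (Q : pred J)
    (F : I -> R) (F' : J -> R) :
  (forall i, P i -> Q (h i)) ->
  (forall j, Q j -> exists! i, P i /\ h i = j) ->
  (forall i, P i -> F i = F' (h i)) ->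
  \big[op/idx]_(j | Q j) F' j = \big[op/idx]_(i | P i) F i.
Proof.
move=> PQ uniq_h FF'; rewrite (partition_big h Q) //=; apply: eq_bigr => j Qj.
have [i [[Pi hij] i_uniq]] := uniq_h j Qj.
rewrite (big_pred1 i) => [|i' /=]; first by rewrite FF' ?hij.
apply/andP/eqP => [[Pi' /eqP hi'] | ->]; last by rewrite hij.
by rewrite (i_uniq i').
Qed.
End BigFibre.

(** * The fixed-point Tambara functor of a G-ring *)

Section Fixed.
Variables (gT : finGroupType) (R : gring gT).

Definition fixed_pred (X : gset gT) : {pred {ffun X -> R}} :=
  fun f => [forall x, forall g, f (gact X x g) == gring_act R (f x) g].
Arguments fixed_pred : clear implicits.

Record fixed (X : gset gT) :=
  Fixed { fixed_val : {ffun X -> R}; _ : fixed_val \in fixed_pred X }.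

HB.instance Definition _ X := [isSub for @fixed_val X].
HB.instance Definition _ X := [Choice of fixed X by <:].

Lemma fixed_predP (X : gset gT) (f : {ffun X -> R}) :
  reflect (forall x g, f (gact X x g) = gring_act R (f x) g)
          (f \in fixed_pred X).
Proof.
by apply: (iffP forallP) => [Pf x g|Pf x]; [apply/eqP; move/forallP: (Pf x) |
  apply/forallP=> g; apply/eqP].
Qed.

Lemma fixed_subring_closed X : subring_closed (fixed_pred X).
Proof.
split=> [|a b /fixed_predP Pa /fixed_predP Pb|
          a b /fixed_predP Pa /fixed_predP Pb]; apply/fixed_predP => x g.
- by rewrite !ffunE (gring_actM R g).1.
- by rewrite !ffunE Pa Pb -(gring_actB R g).
- by rewrite !ffunE Pa Pb -(gring_actM R g).2.
Qed.

HB.instance Definition _ X :=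
  GRing.isSubringClosed.Build _ (fixed_pred X) (fixed_subring_closed X).
HB.instance Definition _ X :=
  GRing.SubChoice_isSubPzRing.Build _ _ (fixed X) (fixed_subring_closed X).

Lemma fixed_mulC X : commutative (@GRing.mul (fixed X)).
Proof.
by move=> a b; apply: val_inj; apply/ffunP=> x; rewrite !ffunE mulrC.
Qed.

HB.instance Definition _ X :=
  GRing.PzRing_hasCommutativeMul.Build (fixed X) (@fixed_mulC X).

Definition fixed_at X (a : fixed X) (x : X) : R := fixed_val a x.
Coercion fixed_at : fixed >-> Funclass.

Lemma fixed_act X (a : fixed X) x g : a (gact X x g) = gring_act R (a x) g.
Proof. by apply: fixed_predP; case: a. Qed.

Lemma fixedP X (a b : fixed X) : a =1 b -> a = b.
Proof. by move=> eq_ab; apply: val_inj; apply/ffunP => x; exact: eq_ab. Qed.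

Lemma fixed_of_subproof (X : gset gT) (f : X -> R) :
  (forall x g, f (gact X x g) = gring_act R (f x) g) ->
  finfun f \in fixed_pred X.
Proof. by move=> Pf; apply/fixed_predP => x g; rewrite !ffunE. Qed.

Definition fixed_of (X : gset gT) (f : X -> R) Pf : fixed X :=
  Fixed (@fixed_of_subproof X f Pf).

Lemma fixed_ofE (X : gset gT) (f : X -> R) Pf : @fixed_of X f Pf =1 f.
Proof. by move=> x; rewrite /fixed_at /= ffunE. Qed.

Lemma fixedB X (a b : fixed X) x : (a - b) x = a x - b x.
Proof. by rewrite /fixed_at /= !ffunE. Qed.
Lemma fixedM X (a b : fixed X) x : (a * b) x = a x * b x.
Proof. by rewrite /fixed_at /= !ffunE. Qed.
Lemma fixed1 X x : (1 : fixed X) x = 1.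
Proof. by rewrite /fixed_at /= !ffunE. Qed.

(** The action of one group element, named so that it can carry the structure
    of a ring morphism. *)
Definition gring_actr (g : gT) : R -> R := (gring_act R)^~ g.
HB.instance Definition _ g :=
  GRing.isZmodMorphism.Build R R (gring_actr g) (gring_actB R g).
HB.instance Definition _ g :=
  GRing.isMonoidMorphism.Build R R (gring_actr g) (gring_actM R g).

Lemma fibre_act (X Y : gset gT) (f : gmap X Y) y g x :
  (f (gact X x g) == gact Y y g) = (f x == y).
Proof. by rewrite gmapP (inj_eq (act_inj _ g)). Qed.

Lemma fixed_tr_subproof (X Y : gset gT) (f : gmap X Y) (a : fixed X) y g :
  \sum_(x | f x == gact Y y g) a x = gring_act R (\sum_(x | f x == y) a x) g.
Proof.
rewrite -[RHS]/(gring_actr g _) raddf_sum (reindex_inj (act_inj (gact X) g)) /=.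
by apply: eq_big => [x|x _]; rewrite ?fibre_act ?fixed_act.
Qed.

Lemma fixed_nm_subproof (X Y : gset gT) (f : gmap X Y) (a : fixed X) y g :
  \prod_(x | f x == gact Y y g) a x = gring_act R (\prod_(x | f x == y) a x) g.
Proof.
rewrite -[RHS]/(gring_actr g _) rmorph_prod (reindex_inj (act_inj (gact X) g)) /=.
by apply: eq_big => [x|x _]; rewrite ?fibre_act ?fixed_act.
Qed.

Lemma fixed_res_subproof (X Y : gset gT) (f : gmap X Y) (a : fixed Y) x g :
  a (f (gact X x g)) = gring_act R (a (f x)) g.
Proof. by rewrite gmapP fixed_act. Qed.

Section Maps.
Variables (X Y : gset gT) (f : gmap X Y).
Definition fixed_res (a : fixed Y) : fixed X := fixed_of (fixed_res_subproof f a).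
Definition fixed_tr (a : fixed X) : fixed Y := fixed_of (fixed_tr_subproof f a).
Definition fixed_nm (a : fixed X) : fixed Y := fixed_of (fixed_nm_subproof f a).

Lemma fixed_res_zmod : zmod_morphism fixed_res.
Proof. by move=> a b; apply: fixedP => x; rewrite fixedB !fixed_ofE fixedB. Qed.

Lemma fixed_res_monoid : monoid_morphism fixed_res.
Proof.
split=> [|a b]; apply: fixedP => x; first by rewrite fixed_ofE !fixed1.
by rewrite fixedM !fixed_ofE fixedM.
Qed.

Lemma fixed_tr_zmod : zmod_morphism fixed_tr.
Proof.
move=> a b; apply: fixedP => x; rewrite fixedB !fixed_ofE -sumrB.
by apply: eq_bigr => z _; rewrite fixedB.
Qed.

Lemma fixed_nm_monoid : monoid_morphism fixed_nm.
Proof.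
split=> [|a b]; apply: fixedP => x.
  by rewrite fixed_ofE fixed1 big1 // => z _; rewrite fixed1.
rewrite fixedM !fixed_ofE -big_split.
by apply: eq_bigr => z _; rewrite fixedM.
Qed.

HB.instance Definition _ :=
  GRing.isZmodMorphism.Build _ _ fixed_res fixed_res_zmod.
HB.instance Definition _ :=
  GRing.isMonoidMorphism.Build _ _ fixed_res fixed_res_monoid.
HB.instance Definition _ :=
  GRing.isZmodMorphism.Build _ _ fixed_tr fixed_tr_zmod.
End Maps.

Lemma fixed_tval_sum (X Y : gset gT) :
  bijective (fun a : fixed (gsum X Y) =>
    (fixed_res (ginl X Y) a, fixed_res (ginr X Y) a)).
Proof.
pose glue (ab : fixed X * fixed Y) (z : gsum X Y) :=
  match z with inl x => ab.1 x | inr y => ab.2 y end.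
have glue_act ab z g :
  glue ab (gact (gsum X Y) z g) = gring_act R (glue ab z) g.
  by case: z => z; exact: fixed_act.
exists (fun ab => fixed_of (glue_act ab)) => [a|[a b]].
  by apply: fixedP => -[] z; rewrite !fixed_ofE /= fixed_ofE.
by congr (_, _); apply: fixedP => z; rewrite !fixed_ofE.
Qed.

Lemma pullback_lift (X Y Z W : gset gT) (f : gmap X Y) (g : gmap Z Y)
    (fst : gmap W X) (snd : gmap W Z) (z : Z) x :
  pullback_square f g fst snd -> f x == g z ->
  exists! w, snd w == z /\ fst w = x.
Proof.
move=> [_ uni] /eqP /uni [w [[fw sw] uw]].
exists w; split=> [|w' [/eqP sw' fw']]; last by apply: uw.
by split=> //; apply/eqP.
Qed.

Lemma fixed_tr_pullback (X Y Z W : gset gT) (f : gmap X Y) (g : gmap Z Y)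
    (fst : gmap W X) (snd : gmap W Z) :
  pullback_square f g fst snd ->
  fixed_res g \o fixed_tr f =1 fixed_tr snd \o fixed_res fst.
Proof.
move=> pb a; apply: fixedP => z; rewrite !fixed_ofE.
apply: (@big_unique_preim _ _ _ _ _ fst) => [w /eqP <-|x|w _]; last by rewrite fixed_ofE.
  by rewrite pb.1.
exact: pullback_lift.
Qed.

Lemma fixed_nm_pullback (X Y Z W : gset gT) (f : gmap X Y) (g : gmap Z Y)
    (fst : gmap W X) (snd : gmap W Z) :
  pullback_square f g fst snd ->
  fixed_res g \o fixed_nm f =1 fixed_nm snd \o fixed_res fst.
Proof.
move=> pb a; apply: fixedP => z; rewrite !fixed_ofE.
apply: (@big_unique_preim _ _ _ _ _ fst) => [w /eqP <-|x|w _]; last by rewrite fixed_ofE.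
  by rewrite pb.1.
exact: pullback_lift.
Qed.

(** The exponential formula is the distributivity of products over sums: the
    choices of one term in each factor are the sections of [p] over a fibre of
    [f], and these are the points of [P]. *)
Lemma fixed_nm_tr (X Y A P W : gset gT) (f : gmap X Y) (p : gmap A X)
    (q : gmap P Y) (r : gmap W X) (f' : gmap W P) (e : gmap W A) :
  exponential_diagram f p q r f' e ->
  fixed_nm f \o fixed_tr p =1 fixed_tr q \o fixed_nm f' \o fixed_res e.
Proof.
move=> [pb pe uni] a; apply: fixedP => y; rewrite !fixed_ofE.
(* Sections are encoded as total functions X -> option A, with value None off
   the fibre, because A may be empty. *)
pose Q x (o : option A) := oapp (fun c => p c == x) false o.
pose aO (o : option A) := oapp a 0 o.
transitivity (\prod_(x | f x == y) \sum_(o | Q x o) aO o).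
  apply: eq_bigr => x _; rewrite fixed_ofE; apply: esym.
  apply: (@big_unique_preim _ _ _ _ _ Some) => // -[c|] //= pcx.
  by exists c; split=> // c' [_ []].
rewrite (big_distr_big_dep None).
(* The section of p over f^-1 (q b) that a point b of P encodes. *)
pose sec b := [ffun x => omap e [pick w | (r w == x) && (f' w == b)]].
have secS w b : f' w = b -> sec b (r w) = Some (e w).
  move=> wb; rewrite ffunE; case: pickP => [w' /andP[/eqP rw' /eqP fw']|/(_ w)].
    have [v [_ uv]] := pb.2 (r w) b (etrans (pb.1 w) (congr1 q wb)).
    by rewrite /= -(uv w) // -(uv w').
  by rewrite wb !eqxx.
have secN x b : f x <> q b -> sec b x = None.
  rewrite ffunE; case: pickP => // w /andP[/eqP rw /eqP fw] [].
  by rewrite -rw pb.1 fw.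
have overP x b : f x = q b -> exists2 w, r w = x & f' w = b.
  by move=> /pb.2[w [[rw fw] _]]; exists w.
apply: (@big_unique_preim _ _ _ _ _ sec) => [b /eqP qb|s s_fam|b /eqP qb].
- apply/pfamilyP; split=> [|x /eqP fx].
    apply/supportP => x; rewrite unfold_in /= => /eqP fx.
    by apply: secN; rewrite qb.
  have [w rw fw] := overP x b (etrans fx (esym qb)).
  by rewrite -rw (secS w b fw) unfold_in /= pe.
- have /pfamilyP[/supportP s_supp s_fib] := s_fam.
  have sP x : f x = y -> {c | s x = Some c}.
    move=> /eqP /s_fib; rewrite unfold_in.
    by case: (s x) => // c _; exists c.
  have sPp x (fx : f x = y) : p (sval (sP x fx)) = x.
    case: (sP x fx) => c /= sx; have /eqP /s_fib := fx.
    by rewrite unfold_in sx => /eqP.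
  have [b [[qb eb] b_uniq]] := uni y (fun x fx => sval (sP x fx)) sPp.
  exists b; split=> [|b' [/eqP qb' secb']].
    split; first exact/eqP.
    apply/ffunP => x; have [fx|/eqP fx] := eqVneq (f x) y; last first.
      by rewrite secN ?qb // s_supp // unfold_in; apply/eqP.
    have [w rw fw] := overP x b (etrans fx (esym qb)).
    have wy : f (r w) = y by rewrite rw.
    rewrite -rw (secS w b fw) (eb w wy fw).
    by case: (sP _ wy).
  apply: b_uniq; split=> // w wy fw; case: (sP _ wy) => c /=.
  by rewrite -secb' (secS w b' fw) => -[].
- rewrite fixed_ofE; apply: esym.
  apply: (@big_unique_preim _ _ _ _ _ r) => [w /eqP fw|x /eqP fx|w /eqP fw].
  + by rewrite pb.1 fw qb.
  + have [w rw fw] := overP x b (etrans fx (esym qb)).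
    exists w; split=> [|w' [/eqP fw' rw']]; first by rewrite fw.
    have [v [_ uv]] := pb.2 x b (etrans fx (esym qb)).
    by rewrite -(uv w) // -(uv w').
  + by rewrite (secS w b fw) /= fixed_ofE.
Qed.

Definition fixed_tambara : tambara gT.
Proof.
refine (@Tambara gT (fun X => fixed X : comPzRingType) (fun X Y f => fixed_res f)
  (fun X Y f => fixed_tr f) fixed_nm
  fixed_nm_monoid _ _ _ _ _ _ _ fixed_tval_sum
  fixed_tr_pullback fixed_nm_pullback fixed_nm_tr).
- by move=> X f f_id a; apply: fixedP => x; rewrite fixed_ofE f_id.
- move=> X f f_id a; apply: fixedP => x; rewrite fixed_ofE.
  by rewrite (big_pred1 x) // => z; rewrite f_id.
- move=> X f f_id a; apply: fixedP => x; rewrite fixed_ofE.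
  by rewrite (big_pred1 x) // => z; rewrite f_id.
- by move=> X Y Z f g h hgf a; apply: fixedP => x; rewrite !fixed_ofE hgf.
- move=> X Y Z f g h hgf a; apply: fixedP => z; rewrite !fixed_ofE.
  rewrite (partition_big f (fun y => g y == z)) => [|x]; last by rewrite hgf.
  apply: eq_bigr => y /eqP gy; rewrite fixed_ofE; apply: eq_bigl => x.
  by rewrite hgf /= andb_idl // => /eqP->; rewrite gy.
- move=> X Y Z f g h hgf a; apply: fixedP => z; rewrite !fixed_ofE.
  rewrite (partition_big f (fun y => g y == z)) => [|x]; last by rewrite hgf.
  apply: eq_bigr => y /eqP gy; rewrite fixed_ofE; apply: eq_bigl => x.
  by rewrite hgf /= andb_idl // => /eqP->; rewrite gy.
- by move=> a; apply: fixedP => -[].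
Defined.
End Fixed.

(** * Kernel pairs and injectivity of monic morphisms *)

Lemma tmorphism_res (gT : finGroupType) (k l : tambara gT) (F : tmorphism k l)
  (X Y : gset gT) (f : gmap X Y) a : F X (res k f a) = res l f (F Y a).
Proof. exact: tmor_res. Qed.

Lemma tmorphism_tr (gT : finGroupType) (k l : tambara gT) (F : tmorphism k l)
  (X Y : gset gT) (f : gmap X Y) a : F Y (tr k f a) = tr l f (F X a).
Proof. exact: tmor_tr. Qed.

Lemma tmorphism_nm (gT : finGroupType) (k l : tambara gT) (F : tmorphism k l)
  (X Y : gset gT) (f : gmap X Y) a : F Y (nm k f a) = nm l f (F X a).
Proof. exact: tmor_nm. Qed.

Section KernelPair.
Variables (gT : finGroupType) (k l : tambara gT) (F : tmorphism k l).

Definition kpair_pred (X : gset gT) : {pred k X * k X} :=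
  fun ab => F X ab.1 == F X ab.2.
Arguments kpair_pred : clear implicits.

Record kpair (X : gset gT) :=
  KPair { kpair_val : k X * k X; _ : kpair_val \in kpair_pred X }.

HB.instance Definition _ X := [isSub for @kpair_val X].
HB.instance Definition _ X := [Choice of kpair X by <:].

Lemma kpair_subring_closed X : subring_closed (kpair_pred X).
Proof.
split=> [|a b /eqP Pa /eqP Pb|a b /eqP Pa /eqP Pb]; apply/eqP.
- by rewrite !rmorph1.
- by rewrite !rmorphB Pa Pb.
- by rewrite !rmorphM Pa Pb.
Qed.

HB.instance Definition _ X :=
  GRing.isSubringClosed.Build _ (kpair_pred X) (kpair_subring_closed X).
HB.instance Definition _ X :=
  GRing.SubChoice_isSubPzRing.Build _ _ (kpair X) (kpair_subring_closed X).

Lemma kpair_mulC X : commutative (@GRing.mul (kpair X)).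
Proof. by move=> a b; apply: val_inj; rewrite !rmorphM mulrC. Qed.

HB.instance Definition _ X :=
  GRing.PzRing_hasCommutativeMul.Build (kpair X) (@kpair_mulC X).

Lemma kpairE X (a : kpair X) : F X (val a).1 = F X (val a).2.
Proof. by apply/eqP; case: a. Qed.

Definition kpair1 X (a : kpair X) : k X := (val a).1.
Definition kpair2 X (a : kpair X) : k X := (val a).2.

Lemma kpair_inj X (a b : kpair X) :
  kpair1 a = kpair1 b -> kpair2 a = kpair2 b -> a = b.
Proof.
rewrite /kpair1 /kpair2 => e1 e2; apply: val_inj.
by rewrite [LHS]surjective_pairing e1 e2 -surjective_pairing.
Qed.

Lemma kpair1_zmod X : zmod_morphism (@kpair1 X). Proof. by []. Qed.
Lemma kpair2_zmod X : zmod_morphism (@kpair2 X). Proof. by []. Qed.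
Lemma kpair1_monoid X : monoid_morphism (@kpair1 X). Proof. by []. Qed.
Lemma kpair2_monoid X : monoid_morphism (@kpair2 X). Proof. by []. Qed.
HB.instance Definition _ X :=
  GRing.isZmodMorphism.Build _ _ (@kpair1 X) (@kpair1_zmod X).
HB.instance Definition _ X :=
  GRing.isMonoidMorphism.Build _ _ (@kpair1 X) (@kpair1_monoid X).
HB.instance Definition _ X :=
  GRing.isZmodMorphism.Build _ _ (@kpair2 X) (@kpair2_zmod X).
HB.instance Definition _ X :=
  GRing.isMonoidMorphism.Build _ _ (@kpair2 X) (@kpair2_monoid X).

Section Maps.
Variables (X Y : gset gT) (f : gmap X Y).

Lemma kpair_res_subproof (a : kpair Y) :
  (res k f (kpair1 a), res k f (kpair2 a)) \in kpair_pred X.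
Proof. by apply/eqP; rewrite /= !tmorphism_res kpairE. Qed.
Lemma kpair_tr_subproof (a : kpair X) :
  (tr k f (kpair1 a), tr k f (kpair2 a)) \in kpair_pred Y.
Proof. by apply/eqP; rewrite /= !tmorphism_tr kpairE. Qed.
Lemma kpair_nm_subproof (a : kpair X) :
  (nm k f (kpair1 a), nm k f (kpair2 a)) \in kpair_pred Y.
Proof. by apply/eqP; rewrite /= !tmorphism_nm kpairE. Qed.

Definition kpair_res (a : kpair Y) : kpair X := KPair (kpair_res_subproof a).
Definition kpair_tr (a : kpair X) : kpair Y := KPair (kpair_tr_subproof a).
Definition kpair_nm (a : kpair X) : kpair Y := KPair (kpair_nm_subproof a).

Lemma kpair_res_zmod : zmod_morphism kpair_res.
Proof. by move=> a b; apply: kpair_inj; rewrite raddfB; exact: raddfB. Qed.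

Lemma kpair_res_monoid : monoid_morphism kpair_res.
Proof.
by split=> [|a b]; apply: kpair_inj; rewrite ?rmorph1 ?rmorphM;
  solve [exact: rmorph1 | exact: rmorphM].
Qed.

Lemma kpair_tr_zmod : zmod_morphism kpair_tr.
Proof. by move=> a b; apply: kpair_inj; rewrite raddfB; exact: raddfB. Qed.

Lemma kpair_nm_monoid : monoid_morphism kpair_nm.
Proof.
by split=> [|a b]; apply: kpair_inj; rewrite ?rmorph1 ?rmorphM;
  solve [exact: (nm_monoid k f).1 | exact: (nm_monoid k f).2].
Qed.

HB.instance Definition _ :=
  GRing.isZmodMorphism.Build _ _ kpair_res kpair_res_zmod.
HB.instance Definition _ :=
  GRing.isMonoidMorphism.Build _ _ kpair_res kpair_res_monoid.
HB.instance Definition _ :=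
  GRing.isZmodMorphism.Build _ _ kpair_tr kpair_tr_zmod.
End Maps.

Lemma kpair_tval_sum (X Y : gset gT) :
  bijective (fun a : kpair (gsum X Y) =>
    (kpair_res (ginl X Y) a, kpair_res (ginr X Y) a)).
Proof.
have [glue splitK glueK] := tval_sum k X Y.
have glueE (a : k X) (b : k Y) :
    res k (ginl X Y) (glue (a, b)) = a /\ res k (ginr X Y) (glue (a, b)) = b.
  by case: (glueK (a, b)).
have glue_pred (ab : kpair X * kpair Y) :
    (glue (kpair1 ab.1, kpair1 ab.2), glue (kpair2 ab.1, kpair2 ab.2))
      \in kpair_pred (gsum X Y).
  apply/eqP/(bij_inj (tval_sum l X Y)) => /=.
  rewrite -!tmorphism_res.
  have [-> ->] := glueE (kpair1 ab.1) (kpair1 ab.2).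
  have [-> ->] := glueE (kpair2 ab.1) (kpair2 ab.2).
  by rewrite !kpairE.
exists (fun ab => KPair (glue_pred ab)) => [a|[a b]].
  by apply: kpair_inj; exact: splitK.
have [e1 e2] := glueE (kpair1 a) (kpair1 b).
have [e3 e4] := glueE (kpair2 a) (kpair2 b).
by congr (_, _); apply: kpair_inj.
Qed.

Definition kernel_pair : tambara gT.
Proof.
refine (@Tambara gT (fun X => kpair X : comPzRingType) (fun X Y f => kpair_res f)
  (fun X Y f => kpair_tr f) kpair_nm
  kpair_nm_monoid _ _ _ _ _ _ _ kpair_tval_sum _ _ _).
- by move=> X f f_id a; apply: kpair_inj; exact: res_id.
- by move=> X f f_id a; apply: kpair_inj; exact: tr_id.
- by move=> X f f_id a; apply: kpair_inj; exact: nm_id.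
- by move=> X Y Z f g h hgf a; apply: kpair_inj; exact: res_comp.
- by move=> X Y Z f g h hgf a; apply: kpair_inj; exact: tr_comp.
- by move=> X Y Z f g h hgf a; apply: kpair_inj; exact: nm_comp.
- by move=> a; apply: kpair_inj; rewrite [LHS]tval_empty [RHS]tval_empty.
- by move=> X Y Z W f g fst snd pb a; apply: kpair_inj; exact: (tr_pullback pb).
- by move=> X Y Z W f g fst snd pb a; apply: kpair_inj; exact: (nm_pullback pb).
- by move=> X Y A P W f p q r f' e ed a; apply: kpair_inj; exact: (nm_tr ed).
Defined.

Definition kernel_pair1 : tmorphism kernel_pair k :=
  @TMorphism gT kernel_pair k (fun X => @kpair1 X) (fun _ _ _ _ => erefl)
    (fun _ _ _ _ => erefl) (fun _ _ _ _ => erefl).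

Definition kernel_pair2 : tmorphism kernel_pair k :=
  @TMorphism gT kernel_pair k (fun X => @kpair2 X) (fun _ _ _ _ => erefl)
    (fun _ _ _ _ => erefl) (fun _ _ _ _ => erefl).

(** If [F X a = F X b] then [(a, b)] is a point of the kernel pair, and the two
    projections, being equalised by [F], agree on it. *)
Lemma tmonic_inj : tmonic F -> forall X, injective (F X).
Proof.
move=> monF X a b /eqP Fab.
exact: (monF kernel_pair kernel_pair1 kernel_pair2 (fun Y c => kpairE c) X
  (KPair (Fab : (a, b) \in kpair_pred X))).
Qed.
End KernelPair.

(** * Transfers and norms on copies of the free orbit *)

Section Copies.
Variable gT : finGroupType.

Definition gid (X : gset gT) : gmap X X := @GMap gT X X id (fun _ _ => erefl).

Lemma res_ext (k : tambara gT) (X Y : gset gT) (f g : gmap X Y) :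
  f =1 g -> res k f =1 res k g.
Proof.
move=> fg a; rewrite [LHS](@res_comp gT k X Y Y g (gid Y) f fg a) /=.
by rewrite res_id.
Qed.

Definition gpoint (X : gset gT) (x : X) : gmap (gfree gT) X :=
  @GMap gT (gfree gT) X (fun g => gact X x g) (fun g h => actM (gact X) x g h).

Section GCopies.
Variable n : nat.
Lemma copies_act1 : (fun (z : 'I_n * gT) g => (z.1, z.2 * g)%g)^~ 1%g =1 id.
Proof. by case=> t x; rewrite mulg1. Qed.
Lemma copies_actM (z : 'I_n * gT) :
  act_morph (fun (z : 'I_n * gT) g => (z.1, z.2 * g)%g) z.
Proof. by move=> g h; rewrite /= mulgA. Qed.

Definition gcopies : gset gT := GSet (TotalAction copies_act1 copies_actM).
Definition gcopy (i : 'I_n) : gmap (gfree gT) gcopies :=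
  @GMap gT (gfree gT) gcopies (fun x => (i, x)) (fun _ _ => erefl).
Definition gfold : gmap gcopies (gfree gT) :=
  @GMap gT gcopies (gfree gT) snd (fun _ _ => erefl).
End GCopies.

Variable k : tambara gT.

Lemma res_inj_retract (X Y : gset gT) (f : gmap X Y) (g : gmap Y X) :
  cancel g f -> injective (res k f).
Proof.
move=> gK; apply: (can_inj (g := res k g)) => a.
rewrite -[LHS](@res_comp gT k Y X Y g f (gid Y) (fun y => esym (gK y)) a).
exact: res_id.
Qed.

(** Additivity of [k], iterated over the copies. *)
Lemma gcopies_res_inj n (a b : k (gcopies n)) :
  (forall i, res k (gcopy i) a = res k (gcopy i) b) -> a = b.
Proof.
elim: n a b => [|n IHn] a b eq_ab.
  pose e (z : gempty gT) : gcopies 0 := match z with end.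
  have eP z g : e (gact (gempty gT) z g) = gact (gcopies 0) (e z) g by case: z.
  pose d (z : gcopies 0) : gempty gT :=
    False_rect _ (notF (ltn_ord z.1)).
  have dP z g : d (gact (gcopies 0) z g) = gact (gempty gT) (d z) g.
    by case: z => -[].
  apply: (@res_inj_retract _ _ (GMap eP) (GMap dP)) => [[[]]//|].
  by rewrite [LHS]tval_empty [RHS]tval_empty.
pose c (z : gsum (gfree gT) (gcopies n)) : gcopies n.+1 :=
  match z with inl x => (ord0, x) | inr y => (lift ord0 y.1, y.2) end.
have cP z g : c (gact (gsum _ _) z g) = gact (gcopies _) (c z) g by case: z.
pose d (z : gcopies n.+1) : gsum (gfree gT) (gcopies n) :=
  if unlift ord0 z.1 is Some i then inr (i, z.2) else inl z.2.
have dP z g : d (gact (gcopies _) z g) = gact (gsum _ _) (d z) g.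
  by rewrite /d /=; case: unliftP.
apply: (@res_inj_retract _ _ (GMap cP) (GMap dP)) => [[i x]|].
  by rewrite /= /d /=; case: unliftP => [j|] /= ->.
apply: (bij_inj (tval_sum k _ _)); congr (_, _).
  have E u : res k (ginl _ _) (res k (GMap cP) u) = res k (gcopy ord0) u.
    by apply/esym; exact: res_comp.
  by rewrite /= !E eq_ab.
apply: IHn => i.
pose m : gmap (gcopies n) (gcopies n.+1) :=
  @GMap gT (gcopies n) (gcopies n.+1) (fun z => (lift ord0 z.1, z.2))
    (fun _ _ => erefl).
have E u : res k (ginr _ _) (res k (GMap cP) u) = res k m u.
  by apply/esym; exact: res_comp.
have E' u : res k (gcopy i) (res k m u) = res k (gcopy (lift ord0 i)) u.
  by apply/esym; exact: res_comp.
by rewrite /= !E !E' eq_ab.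
Qed.

Lemma nm_empty (Y : gset gT) (f : gmap (gempty gT) Y) a : nm k f a = 1.
Proof. by rewrite (tval_empty a) -(tval_empty 1) (nm_monoid k f).1. Qed.

Lemma tr_empty (Y : gset gT) (f : gmap (gempty gT) Y) a : tr k f a = 0.
Proof. by rewrite (tval_empty a) raddf0. Qed.

Section Fold.
Variable n : nat.
Implicit Types (i j : 'I_n) (a : k (gcopies n)).

Definition gfrom_empty (X : gset gT) : gmap (gempty gT) X :=
  @GMap gT (gempty gT) X (fun z => match z with end) (fun z => match z with end).

Lemma gcopy_pullback_neq i j : i != j ->
  pullback_square (gcopy i) (gcopy j) (gfrom_empty _) (gfrom_empty _).
Proof. by move=> ij; split=> [[]|x z [eij]]; rewrite eij eqxx in ij. Qed.

Lemma gcopy_pullback_eq i : pullback_square (gcopy i) (gcopy i) (gid _) (gid _).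
Proof. by split=> // x z [->]; exists z; split=> // w []. Qed.

(** The norm along the inclusion of one copy has the given value on that copy
    and value 1 on the others, where the pullback is empty; so the product of
    these norms has the same restrictions as [a].  The sum of transfers behaves
    likewise, with 0 for 1. *)
Lemma copies_nm_decomp a :
  a = \prod_(i < n) nm k (gcopy i) (res k (gcopy i) a).
Proof.
apply: gcopies_res_inj => j; rewrite rmorph_prod (bigD1 j) //= big1 => [|i ij].
  rewrite mulr1 [RHS](nm_pullback (gcopy_pullback_eq j)) /=.
  by rewrite nm_id // res_id.
by rewrite [LHS](nm_pullback (gcopy_pullback_neq ij)) /= nm_empty.
Qed.

Lemma copies_tr_decomp a :
  a = \sum_(i < n) tr k (gcopy i) (res k (gcopy i) a).
Proof.
apply: gcopies_res_inj => j; rewrite raddf_sum (bigD1 j) //= big1 => [|i ij].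
  rewrite addr0 [RHS](tr_pullback (gcopy_pullback_eq j)) /=.
  by rewrite tr_id // res_id.
by rewrite [LHS](tr_pullback (gcopy_pullback_neq ij)) /= tr_empty.
Qed.

Lemma nm_fold a : nm k (gfold n) a = \prod_(i < n) res k (gcopy i) a.
Proof.
rewrite [in LHS](copies_nm_decomp a).
rewrite (big_morph _ (nm_monoid k (gfold _)).2 (nm_monoid k _).1).
apply: eq_bigr => i _.
by rewrite -[LHS](@nm_comp gT k _ _ _ (gcopy i) (gfold _) (gid _) (fun=> erefl)) nm_id.
Qed.

Lemma tr_fold a : tr k (gfold n) a = \sum_(i < n) res k (gcopy i) a.
Proof.
rewrite [in LHS](copies_tr_decomp a) raddf_sum; apply: eq_bigr => i _.
by rewrite -[LHS](@tr_comp gT k _ _ _ (gcopy i) (gfold _) (gid _) (fun=> erefl)) tr_id.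
Qed.
End Fold.

(** * The double coset formula at the free orbit *)

Section Fibre.
Variables (X Y : gset gT) (f : gmap X Y) (y : Y).

Definition fibre := [set x | f x == y].

Definition gfibre_map : gmap (gcopies #|fibre|) X :=
  @GMap gT (gcopies #|fibre|) X (fun z => gact X (enum_val z.1) z.2)
    (fun z => actM (gact X) (enum_val z.1) z.2).

(** As the free orbit has trivial stabilisers, the pullback of [f] to it is one
    copy of it for each point of the fibre over [y]. *)
Lemma gfibre_pullback : pullback_square f (gpoint y) gfibre_map (gfold _).
Proof.
split=> [[i g]|x g /= fx].
  by rewrite /= gmapP; have := enum_valP i; rewrite inE => /eqP->.
have x_fib : gact X x (g : gT)^-1%g \in fibre by rewrite inE gmapP fx actK.
exists (enum_rank_in x_fib (gact X x (g : gT)^-1%g), g); split=> [|[i h] /= [ix hg]].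
  by rewrite /= enum_rankK_in // actKV.
congr (_, _); last by rewrite hg.
by apply: enum_val_inj; rewrite enum_rankK_in // -ix hg actK.
Qed.

Lemma res_gfibre i a :
  res k (gcopy i) (res k gfibre_map a) = res k (gpoint (enum_val i)) a.
Proof. by apply: esym; exact: res_comp. Qed.

Lemma res_gpoint_nm (a : k X) :
  res k (gpoint y) (nm k f a) = \prod_(x | f x == y) res k (gpoint x) a.
Proof.
rewrite [LHS](nm_pullback gfibre_pullback) /= nm_fold.
rewrite (eq_bigr _ (fun i _ => res_gfibre i a)).
rewrite -(big_enum_val (fun x => res k (gpoint x) a)).
by apply: eq_bigl => x; rewrite inE.
Qed.

Lemma res_gpoint_tr (a : k X) :
  res k (gpoint y) (tr k f a) = \sum_(x | f x == y) res k (gpoint x) a.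
Proof.
rewrite [LHS](tr_pullback gfibre_pullback) /= tr_fold.
rewrite (eq_bigr _ (fun i _ => res_gfibre i a)).
rewrite -(big_enum_val (fun x => res k (gpoint x) a)).
by apply: eq_bigl => x; rewrite inE.
Qed.
End Fibre.
End Copies.

(** * The morphism to a fixed-point functor *)

Section ToFixed.
Variables (gT : finGroupType) (k : tambara gT) (S : gring gT).
Variables (phi : {rmorphism bottom k -> S}).
Hypothesis phi_act : forall a g,
  phi (gring_act (bottom k) a g) = gring_act S (phi a) g.

Lemma to_fixed_subproof (X : gset gT) (a : k X) x g :
  phi (res k (gpoint (gact X x g)) a) = gring_act S (phi (res k (gpoint x) a)) g.
Proof.
rewrite -phi_act; congr (phi _).
by apply: (@res_comp gT k) => h; rewrite /= actM.
Qed.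

Definition to_fixed (X : gset gT) (a : k X) : fixed S X :=
  fixed_of (to_fixed_subproof a).

Lemma to_fixed_zmod X : zmod_morphism (@to_fixed X).
Proof.
move=> a b; apply: fixedP => x; rewrite fixedB !fixed_ofE.
by rewrite !rmorphB.
Qed.
Lemma to_fixed_monoid X : monoid_morphism (@to_fixed X).
Proof.
split=> [|a b]; apply: fixedP => x; first by rewrite fixed1 fixed_ofE !rmorph1.
by rewrite fixedM !fixed_ofE !rmorphM.
Qed.
HB.instance Definition _ X :=
  GRing.isZmodMorphism.Build _ _ (@to_fixed X) (@to_fixed_zmod X).
HB.instance Definition _ X :=
  GRing.isMonoidMorphism.Build _ _ (@to_fixed X) (@to_fixed_monoid X).

Definition fixed_morphism : tmorphism k (fixed_tambara S).
Proof.
refine (@TMorphism gT k (fixed_tambara S) (fun X => @to_fixed X) _ _ _).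
- move=> X Y f a; apply: fixedP => x; rewrite /= !fixed_ofE; congr (phi _).
  by apply/esym/res_comp => h; rewrite /= gmapP.
- move=> X Y f a; apply: fixedP => y; rewrite /= !fixed_ofE.
  rewrite res_gpoint_tr rmorph_sum; apply: eq_bigr => x _.
  by rewrite fixed_ofE.
- move=> X Y f a; apply: fixedP => y; rewrite /= !fixed_ofE.
  rewrite res_gpoint_nm rmorph_prod; apply: eq_bigr => x _.
  by rewrite fixed_ofE.
Defined.

End ToFixed.

(** * Quotient of a G-ring by an invariant element *)

(** The composition laws of an action on a type that need not be finite. *)
Lemma total_actM (gT : finGroupType) (T : Type) (to : {action gT &-> T}) x g h :
  to x (g * h)%g = to (to x g) h.
Proof. by case: to => f fP /=; have [_ fM] := fP; apply: fM; rewrite inE. Qed.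

Lemma total_act1 (gT : finGroupType) (T : Type) (to : {action gT &-> T}) x :
  to x 1%g = x.
Proof.
have to_inj : left_injective to by case: to => f [].
by apply: (to_inj 1%g); rewrite -total_actM mulg1.
Qed.

(** Membership in an ideal need not be decidable, so it is made boolean by
    excluded middle. *)
Section PrincipalIdeal.
Variables (R : comNzRingType) (a : R).
Hypothesis a_nonunit : forall z, a * z <> 1.

Definition multiple : pred R := fun x => `[< exists z, x = a * z >].

Fact multiple_idealr : idealr_closed multiple.
Proof.
split=> [||b x y].
- by apply/asboolP; exists 0; rewrite mulr0.
- by rewrite unfold_in; apply/asboolPn => -[z /esym]; exact: a_nonunit.
- move=> /asboolP[u ->] /asboolP[v ->]; apply/asboolP.
  by exists (b * u + v); rewrite mulrDr mulrCA.
Qed.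

Definition principal_idealr : idealr R :=
  HB.pack_for (idealr R) multiple (isIdealr.Build R multiple multiple_idealr).

Definition principal_quot := Quotient.quot principal_idealr.

Lemma principal_quot_eq (x y : R) :
  \pi_principal_quot x = \pi_principal_quot y <-> exists z, x - y = a * z.
Proof.
split=> [/eqP | [z xy]]; last apply/eqP; rewrite -Quotient.idealrBE.
  by move/asboolP.
by apply/asboolP; exists z.
Qed.

Lemma principal_quot_onto (q : principal_quot) : exists x, \pi_principal_quot x = q.
Proof. by exists (generic_quotient.repr q); rewrite reprK. Qed.
End PrincipalIdeal.

Section GQuotient.
Variables (gT : finGroupType) (R : comNzRingType) (act : {action gT &-> R}).
Hypothesis actB : forall g, zmod_morphism (act^~ g).
Hypothesis actM : forall g, monoid_morphism (act^~ g).
Variable a : R.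
Hypothesis a_inv : forall g, act a g = a.
Hypothesis a_nonunit : forall z, a * z <> 1.

Local Notation Q := (principal_quot a_nonunit).
Local Notation pi := (\pi_Q : R -> Q).
Definition quot_act (q : Q) g : Q := pi (act (generic_quotient.repr q) g).

Lemma quot_act_pi x g : quot_act (pi x) g = pi (act x g).
Proof.
apply/principal_quot_eq; rewrite -actB.
have [|z ->] := (principal_quot_eq a_nonunit (generic_quotient.repr (pi x)) x).1.
  exact: reprK.
by exists (act z g); rewrite (actM g).2 a_inv.
Qed.

Lemma quot_act1 : quot_act^~ 1%g =1 id.
Proof. by move=> q; rewrite /quot_act /= total_act1 reprK. Qed.

Lemma quot_actMg q : act_morph quot_act q.
Proof.
by have [x <-] := principal_quot_onto q => g h; rewrite !quot_act_pi total_actM.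
Qed.

Lemma quot_actB g : zmod_morphism (quot_act^~ g).
Proof.
move=> q1 q2; have [x1 <-] := principal_quot_onto q1.
have [x2 <-] := principal_quot_onto q2; rewrite -rmorphB !quot_act_pi.
by rewrite actB rmorphB.
Qed.

Lemma quot_actM g : monoid_morphism (quot_act^~ g).
Proof.
split=> [|q1 q2]; first by rewrite -(rmorph1 pi) quot_act_pi (actM g).1.
have [x1 <-] := principal_quot_onto q1.
have [x2 <-] := principal_quot_onto q2; rewrite -rmorphM !quot_act_pi.
by rewrite (actM g).2 rmorphM.
Qed.

Definition quot_gring : gring gT :=
  @GRingWithAction gT Q (TotalAction quot_act1 quot_actMg) quot_actB quot_actM.
End GQuotient.

Lemma principal_quotient (gT : finGroupType) (R : gring gT) (a : R) :
    ginvariant a -> (forall z, a * z <> 1) ->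
  exists (S : gring gT) (phi : {rmorphism R -> S}),
    [/\ forall x g, phi (gring_act R x g) = gring_act S (phi x) g,
        forall y, exists x, phi x = y
      & forall x, phi x = 0 <-> exists z, x = a * z].
Proof.
move=> a_inv a_nonunit.
have R_nz : 1 != 0 :> R.
  by apply/eqP => e; case: (a_nonunit 0); rewrite mulr0 e.
pose Rnz : comNzRingType :=
  HB.pack_for comNzRingType (gring_sort R)
    (GRing.PzSemiRing_isNonZero.Build (gring_sort R) R_nz).
pose S := @quot_gring gT Rnz (gring_act R) (gring_actB R) (gring_actM R) a
  a_inv a_nonunit.
exists S, (\pi_(@principal_quot Rnz a a_nonunit) : {rmorphism Rnz -> _}); split.
- move=> x g; apply: esym.
  exact: (@quot_act_pi gT Rnz _ (gring_actB R) (gring_actM R) a a_inv).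
- by exact: (principal_quot_onto (R := Rnz)).
- move=> x; rewrite -(rmorph0 (\pi_(@principal_quot Rnz a a_nonunit))).
  by rewrite (principal_quot_eq (R := Rnz)) subr0.
Qed.

(** * The underlying ring of a field-like Tambara functor *)

Lemma res_gfree_gpoint (gT : finGroupType) (k : tambara gT) (x : gT)
    (a : bottom k) :
  res k (gpoint (x : gfree gT)) a = gring_act (bottom k) a x.
Proof. exact: res_ext. Qed.

Section FieldLike.
Variables (gT : finGroupType) (k : tambara gT).
Hypothesis k_field_like : field_like k.

Lemma fixed_nonzero (S : gring gT) : 1 != 0 :> S -> nonzero (fixed_tambara S).
Proof.
move=> S_nz; exists (gfree gT); apply: contraNneq S_nz => e.
by rewrite -(fixed1 S (X := gfree gT) 1%g) [1]e -(subrr 1) fixedB subrr.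
Qed.

Lemma field_like_to_fixed_inj (S : gring gT) (phi : {rmorphism bottom k -> S})
    (phi_act : forall a g, phi (gring_act (bottom k) a g) = gring_act S (phi a) g) :
  1 != 0 :> S -> forall X, injective (@to_fixed gT k S phi phi_act X).
Proof.
move=> S_nz.
exact: (tmonic_inj (k_field_like.2 _ (fixed_morphism phi_act) (fixed_nonzero S_nz))).
Qed.

Lemma field_like_bottom_inj (S : gring gT) (phi : {rmorphism bottom k -> S}) :
    (forall a g, phi (gring_act (bottom k) a g) = gring_act S (phi a) g) ->
  1 != 0 :> S -> injective phi.
Proof.
move=> phi_act S_nz a b eq_ab.
apply: (@field_like_to_fixed_inj S phi phi_act S_nz (gfree gT) a b).
apply: fixedP => x; rewrite !fixed_ofE.
by rewrite !res_gfree_gpoint !phi_act eq_ab.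
Qed.

(** The morphism to the fixed-point functor of k(G/e) evaluates an element of
    k(G/H) at a coset [H :* x] by restricting it along [gproj H] and then acting
    by [x], so it factors through this restriction. *)
Lemma field_like_res_inj (H : {group gT}) :
  1 != 0 :> bottom k -> injective (res k (gproj H)).
Proof.
move=> k_nz a b eq_ab.
have idP : forall a g, (idfun : {rmorphism bottom k -> bottom k})
  (gring_act (bottom k) a g) = gring_act (bottom k) a g by [].
apply: (@field_like_to_fixed_inj (bottom k) _ idP k_nz (gcosets H) a b).
apply: fixedP => -[A HA]; rewrite !fixed_ofE /=.
have /rcosetsP[x _ defA] := HA.
have E c : res k (gpoint (exist _ A HA : gcosets H)) c =
    res k (gtrans x) (res k (gproj H) c).
  apply: res_comp => g; apply: val_inj.
  by rewrite /= defA rcosetM.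
by rewrite !E eq_ab.
Qed.

(** Otherwise the quotient by [a] is a nonzero G-ring, and the map to it is
    injective although it kills [a]. *)
Lemma field_like_invariant_unit (a : bottom k) :
  ginvariant a -> a != 0 -> exists b, a * b = 1.
Proof.
move=> a_inv; apply: contraNP => a_nonunit.
have a_nonunit' z : a * z <> 1 by move=> az; apply: a_nonunit; exists z.
have [S [phi [phi_act _ phi_ker]]] := principal_quotient a_inv a_nonunit'.
have S_nz : 1 != 0 :> S.
  rewrite -(rmorph1 phi); apply/eqP => /phi_ker[z /esym].
  exact: a_nonunit'.
apply/eqP/(field_like_bottom_inj phi_act S_nz); rewrite rmorph0.
by apply/phi_ker; exists 1; rewrite mulr1.
Qed.
End FieldLike.

Section Frobenius.
Variables (p : nat) (p_prime : prime p) (R : comPzRingType).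
Hypothesis charR : has_char R p.

Lemma has_char_nonzero : 1 != 0 :> R.
Proof.
apply/eqP => /(charR 1); rewrite dvdn1 => /eqP p1.
by move: p_prime; rewrite p1.
Qed.

Lemma frobeniusB : zmod_morphism (@frobenius R p).
Proof.
pose Rnz : comNzRingType := HB.pack_for comNzRingType (GRing.ComPzRing.sort R)
    (GRing.PzSemiRing_isNonZero.Build (GRing.ComPzRing.sort R) has_char_nonzero).
have pcharR : p \in [pchar Rnz].
  by rewrite inE p_prime; apply/eqP/charR.
by move=> x y; exact: (pFrobenius_autB_comm pcharR (mulrC x y)).
Qed.

Lemma frobeniusM : monoid_morphism (@frobenius R p).
Proof. by split=> [|x y]; rewrite /frobenius ?expr1n ?exprMn. Qed.

Lemma iter_frobenius n (x : R) : iter n (frobenius p) x = x ^+ (p ^ n).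
Proof. by elim: n => [|n IHn]; rewrite ?expr1 //= IHn /frobenius -exprM expnSr. Qed.

Lemma iter_frobeniusB n (x y : R) :
  iter n (frobenius p) (x - y) = iter n (frobenius p) x - iter n (frobenius p) y.
Proof. by elim: n => //= n ->; exact: frobeniusB. Qed.

End Frobenius.

(** The Frobenius endomorphism is equivariant, hence injective, and kills the
    elements of square zero. *)
Lemma field_like_reduced (gT : finGroupType) (k : tambara gT) (p : nat) :
    prime p -> field_like k -> has_char (bottom k) p ->
  forall x : bottom k, x * x = 0 -> x = 0.
Proof.
move=> p_prime k_fl char_k x xx0.
pose phi : {rmorphism bottom k -> bottom k} :=
  HB.pack_for {rmorphism bottom k -> bottom k} (@frobenius (bottom k) p)
    (GRing.isZmodMorphism.Build _ _ _ (frobeniusB p_prime char_k))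
    (GRing.isMonoidMorphism.Build _ _ _ (frobeniusM p (bottom k))).
apply: (@field_like_bottom_inj _ k k_fl _ phi).
- by move=> a g; apply/esym; exact: (rmorphXn (@gring_actr gT (bottom k) g) p a).
- exact: (has_char_nonzero p_prime).
rewrite rmorph0 -[LHS]/(x ^+ p) -(subnK (prime_gt1 p_prime)) exprD expr2 xx0.
exact: mulr0.
Qed.

(** * Idempotents and coinduced rings *)

Section Restriction.
Variables (gT : finGroupType) (R : gring gT) (H : {group gT}).

Lemma restr_act1 : (fun (x : R) (h : subg_of H) => gring_act R x (sgval h))^~ 1%g =1 id.
Proof. by move=> x; rewrite /= total_act1. Qed.

Lemma restr_actM (x : R) :
  act_morph (fun (x : R) (h : subg_of H) => gring_act R x (sgval h)) x.
Proof. by move=> g h; rewrite /= total_actM. Qed.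

Definition restr_gring : gring (subg_of H) :=
  @GRingWithAction _ (gring_sort R) (TotalAction restr_act1 restr_actM)
    (fun h => gring_actB R (sgval h)) (fun h => gring_actM R (sgval h)).
End Restriction.

Section OrbitProd.
Variables (gT : finGroupType) (K : gring gT) (x : K).
Implicit Types (S : {set gT}) (g h : gT).

Definition orbit_prod S : K := \prod_(g in S) gring_act K x g.

Lemma orbit_prod_act S h : gring_act K (orbit_prod S) h = orbit_prod (S :* h)%g.
Proof.
rewrite -[LHS]/(gring_actr h _) rmorph_prod [RHS](reindex_inj (mulIg h)).
apply: eq_big => [g|g _]; first by rewrite mem_rcoset mulgK.
by rewrite total_actM.
Qed.

(** This gives orthogonality: if no set larger than [S] has a nonzero product
    then the right-hand side vanishes for [T] different from [S] of the same
    size. *)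
Lemma orbit_prodU S T :
  orbit_prod S * orbit_prod T = orbit_prod (S :|: T) * orbit_prod (S :&: T).
Proof.
rewrite [X in _ * X](big_setID S) [X in _ = X * _](big_setID S) /=.
by rewrite setUK setDUl setDv set0U [S :&: T]setIC -mulrA [X in _ * X]mulrC.
Qed.
End OrbitProd.


Section CosetSum.
Variables (gT : finGroupType) (K : gring gT) (H : {group gT}) (e : K).
Hypothesis e_inv : forall h, h \in H -> gring_act K e h = e.

Lemma act_repr_rcoset (A : {set gT}) x :
  A = (H :* x)%g -> gring_act K e (repr A) = gring_act K e x.
Proof.
move=> ->; have /rcosetP[h Hh ->] := mem_repr_rcoset H x.
by rewrite total_actM e_inv.
Qed.

(** The relative trace of [e] from [H] to the whole group. *)
Definition coset_sum : K :=
  \sum_(A in rcosets H [set: gT]) gring_act K e (repr A).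

Lemma coset_sum_inv : ginvariant coset_sum.
Proof.
move=> g; rewrite -[LHS]/(gring_actr g _) raddf_sum.
have rmulg_inj : injective (fun A : {set gT} => A :* g)%g.
  by apply: can_inj (fun A => A :* g^-1)%g _ => A; rewrite rcosetK.
rewrite [RHS](reindex_inj rmulg_inj); apply: eq_big => [A|A /rcosetsP[x _ ->]].
  apply/rcosetsP/rcosetsP => -[x _ defA]; last first.
    exists (x * g^-1)%g; rewrite ?inE //.
    by rewrite rcosetM -defA rcosetK.
  by exists (x * g)%g; rewrite ?inE // rcosetM defA.
rewrite (act_repr_rcoset (erefl _)) (act_repr_rcoset (esym (rcosetM H x g))).
by rewrite total_actM.
Qed.

(** Orthogonality leaves only the term of the coset [H] itself. *)
Lemma mul_coset_sum : (forall g, g \notin H -> e * gring_act K e g = 0) ->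
  e * coset_sum = e * e.
Proof.
move=> e_orth; rewrite mulr_sumr (bigD1 (H : {set gT})) /=; last first.
  by apply/rcosetsP; exists 1%g; rewrite ?inE ?rcoset1.
rewrite (act_repr_rcoset (esym (rcoset1 H))) total_act1.
rewrite big1 ?addr0 // => A /andP[/rcosetsP[x _ ->] xH].
rewrite (act_repr_rcoset (erefl _)) e_orth //; apply: contraNN xH => Hx.
by rewrite rcoset_id.
Qed.
End CosetSum.

(** The [H]-ring is [e K], taken as the quotient of [K] by the [H]-invariant
    element [1 - e], with projection [pi].  The map [a |-> (g |-> pi (a.g))] is
    injective because the translates of [e] sum to 1, and onto because they are
    orthogonal, so that values at different cosets can be prescribed
    independently. *)
Lemma coind_of_idempotent (gT : finGroupType) (K : gring gT) (H : {group gT})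
    (e : K) :
    (forall h, h \in H -> gring_act K e h = e) -> e != 0 ->
    (forall g, g \notin H -> e * gring_act K e g = 0) ->
    coset_sum H e = 1 ->
  exists R : gring (subg_of H), gring_iso K (coind_gring R).
Proof.
move=> e_inv e_nz e_orth e_sum.
have ee : e * e = e by rewrite -(mul_coset_sum e_inv e_orth) e_sum mulr1.
have [||R [pi [pi_act pi_onto pi_ker]]] :=
  @principal_quotient _ (restr_gring K H) (1 - e).
- move=> h; rewrite -[LHS]/(gring_act K (1 - e) (sgval h)).
  by rewrite (gring_actB K _) (gring_actM K _).1 e_inv ?subgP.
- move=> z ez; move/eqP: e_nz; apply; rewrite -[LHS]mulr1 -[X in _ * X]ez mulrA.
  by rewrite mulrBr mulr1 [e * e]ee subrr mul0r.
exists R.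
have kerP (c : K) : pi c = 0 <-> e * c = 0.
  split=> [/pi_ker[z ->] | ec0].
    by rewrite mulrA mulrBr mulr1 [e * e]ee subrr mul0r.
  by apply/pi_ker; exists c; rewrite mulrBl mul1r [e * c]ec0 subr0.
have pi_e : pi e = 1.
  apply/eqP; rewrite -subr_eq0 -(rmorph1 pi) -rmorphB; apply/eqP/kerP.
  by rewrite mulrBr mulr1 [e * e]ee subrr.
pose tr (a : K) := [ffun g : gT => pi (gring_act K a g)].
have tr_coind a : tr a \in coind_pred R.
  by apply/coind_predP => x h; rewrite !ffunE total_actM (pi_act _ h).
pose Phi (a : K) : coind R := Coind (tr_coind a).
have PhiB : zmod_morphism Phi.
  move=> a b; apply: val_inj; apply/ffunP => g.
  by rewrite !ffunE (gring_actB K g) rmorphB.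
have PhiM : monoid_morphism Phi.
  split=> [|a b]; apply: val_inj; apply/ffunP => g; rewrite !ffunE.
    by rewrite (gring_actM K g).1 rmorph1.
  by rewrite (gring_actM K g).2 rmorphM.
pose F : {rmorphism K -> coind R} := HB.pack_for {rmorphism K -> coind R} Phi
  (GRing.isZmodMorphism.Build _ _ _ PhiB)
  (GRing.isMonoidMorphism.Build _ _ _ PhiM).
exists F; split; last first.
  move=> a g; apply: val_inj; apply/ffunP => x.
  by rewrite !ffunE total_actM.
have F_inj : injective F.
  apply: raddf_inj => a Fa0.
  have orth g : gring_act K e g * a = 0.
    have := congr1 (fun c : coind R => coind_val c g^-1%g) Fa0.
    rewrite !ffunE => /kerP ea.
    rewrite -[RHS](raddf0 (gring_actr g)) -ea.
    rewrite [RHS](rmorphM (gring_actr g)); congr (_ * _).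
    by rewrite -[LHS](total_act1 (gring_act K)) -(mulVg g) total_actM.
  by rewrite -[a]mul1r -e_sum mulr_suml big1.
have F_onto c : exists a, F a = c.
  have [b bP] := choice (fun g => pi_onto (coind_val c g)).
  (* A lift of c (r^-1), cut down to e K and moved by r, for each coset H r. *)
  exists (\sum_(A in rcosets H [set: gT])
            gring_act K (b (repr A)^-1%g * e) (repr A)).
  apply: val_inj; apply/ffunP => x; rewrite ffunE.
  rewrite -[gring_act K _ x]/(gring_actr x _) raddf_sum rmorph_sum.
  have termE A : pi (gring_actr x (gring_act K (b (repr A)^-1%g * e) (repr A)))
      = pi (gring_act K (b (repr A)^-1%g) (repr A * x)%g)
        * pi (gring_act K e (repr A * x)%g).
    rewrite -rmorphM -(gring_actM K _).2 total_actM; congr (pi _).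
  rewrite (eq_bigr _ (fun A _ => termE A)).
  (* At x only the coset of x^-1 contributes. *)
  rewrite (bigD1 (H :* x^-1)%g) /=; last first.
    by apply/rcosetsP; exists x^-1%g; rewrite ?inE.
  rewrite big1 ?addr0 => [|A /andP[/rcosetsP[y _ ->] ne]]; last first.
    have -> : pi (gring_act K e (repr (H :* y) * x)%g) = 0.
      apply/kerP/e_orth; apply: contraNN ne => Hyx.
      rewrite -(rcoset_repr H y).
      apply/eqP/rcoset_eqP; rewrite mem_rcoset invgK //.
    by rewrite mulr0.
  set r := repr _.
  have Hrx : (r * x)%g \in H.
    by have := mem_repr_rcoset H x^-1%g; rewrite mem_rcoset invgK.
  rewrite e_inv // pi_e mulr1.
  have := pi_act (b r^-1%g) (subg H (r * x)%g).
  rewrite /= subgK // => ->; rewrite bP.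
  case: c {bP} => c /= /coind_predP cP.
  by rewrite -cP subgK // mulKg.
have [inv invP] := choice F_onto.
by exists inv => [a|c]; [apply: F_inj; rewrite invP | exact: invP].
Qed.

(** The stabiliser [H] of a largest set [S] with nonzero product is proper for a
    nonunit [x]: otherwise [S] is the whole group, and its product, the norm of
    [x], is invariant and nonzero, so that [x] divides a unit. *)
Lemma field_or_coind (gT : finGroupType) (K : gring gT) :
    1 != 0 :> K ->
    (forall y : K, y * y = 0 -> y = 0) ->
    (forall a : K, ginvariant a -> a != 0 -> exists b, a * b = 1) ->
  is_field K \/ exists (H : {group gT}) (R : gring (subg_of H)),
    H \proper [set: gT] /\ gring_iso K (coind_gring R).
Proof.
move=> K_nz K_red K_inv.
have [K_field|/existsNP[x /not_implyP[x_nz x_nonunit]]] :=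
  pselect (forall x : K, x != 0 -> exists y, x * y = 1); first by left.
right.
pose P S := (S != set0) && (orbit_prod x S != 0).
have P1 : P [set 1%g].
  rewrite /P /orbit_prod big_set1 total_act1 x_nz andbT.
  by apply/set0Pn; exists 1%g; rewrite inE.
have [S /andP[S_n0 y_nz] S_max] := arg_maxnP (fun S : {set gT} => #|S|) P1.
set y := orbit_prod x S in y_nz.
pose H := 'C[S | 'Rs]%G.
have HP h : reflect (S :* h = S)%g (h \in H).
  by rewrite -rcosetE; exact: astab1P.
have y_inv h : h \in H -> gring_act K y h = y.
  by rewrite orbit_prod_act => /HP->.
have y_orth g : g \notin H -> y * gring_act K y g = 0.
  move=> /HP Sg; rewrite orbit_prod_act orbit_prodU.
  suff /eqP-> : orbit_prod x (S :|: S :* g)%g == 0 by rewrite mul0r.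
  apply/negPn/negP => U_nz; apply: Sg.
  have PU : P (S :|: S :* g)%g.
    by rewrite /P U_nz andbT -subset0 subUset subset0 (negPf S_n0).
  have /eqP SU : S == (S :|: S :* g)%g.
    by rewrite eqEcard subsetUl; exact: S_max.
  apply/eqP; rewrite eqEcard card_rcoset leqnn andbT.
  by apply: subset_trans (subsetUr S _) _; rewrite -SU.
have t_inv := coset_sum_inv y_inv.
have t_y := mul_coset_sum y_inv y_orth.
have [|u tu] := K_inv _ t_inv.
  apply: contraNneq y_nz => t0; apply/eqP/K_red.
  by rewrite -t_y t0 mulr0.
have u_inv : ginvariant u.
  move=> g; rewrite -[LHS]mul1r -tu mulrAC.
  rewrite -[X in X * _ * _](t_inv g) -(gring_actM K g).2 tu.
  by rewrite (gring_actM K g).1 mul1r.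
have eE g : gring_act K (y * u) g = gring_act K y g * u.
  by rewrite (gring_actM K g).2 u_inv.
have H_proper : H \proper [set: gT].
  rewrite properT; apply: contra_notN x_nonunit => /eqP HT.
  have S1 : (1%g : gT) \in S.
    have /set0Pn[g Sg] := S_n0.
    have /HP<- : g^-1%g \in H by rewrite HT inE.
    by rewrite mem_rcoset invgK mul1g.
  have [|b yb] := K_inv y _ y_nz; first by move=> g; apply: y_inv; rewrite HT inE.
  move: yb; rewrite /y /orbit_prod (bigD1 1%g) //= total_act1 -mulrA => yb.
  by eexists; exact: yb.
exists H.
have [||||R iso] := @coind_of_idempotent gT K H (y * u); last by exists R.
- by move=> h Hh; rewrite eE y_inv.
- apply: contraNneq y_nz => yu0; apply/eqP.
  by rewrite -[y]mulr1 -tu mulrCA yu0 mulr0.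
- by move=> g Hg; rewrite eE mulrACA y_orth // mul0r.
- rewrite -tu /coset_sum mulr_suml.
  by apply: eq_bigr => A _; rewrite eE.
Qed.

(** * Intermediate fields *)

Lemma gproj_inv (gT : finGroupType) (k : tambara gT) (H : {group gT})
    (a : k (gcosets H)) h :
  h \in H ->
  gring_act (bottom k) (res k (gproj H) a) h = res k (gproj H) a.
Proof.
move=> Hh; apply/esym/(@res_comp gT k) => x; apply: val_inj.
by rewrite /= rcosetM (rcoset_id Hh).
Qed.

(** By the double coset formula the restriction of the norm is the product of
    the [H]-conjugates. *)
Lemma res_nm_gproj (gT : finGroupType) (k : tambara gT) (H : {group gT})
    (a : bottom k) :
    (forall h, h \in H -> gring_act (bottom k) a h = a) ->
  res k (gproj H) (nm k (gproj H) a) = (a : bottom k) ^+ #|H|.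
Proof.
move=> a_inv; pose y : gcosets H := gproj H (1%g : gT).
have -> : res k (gproj H) (nm k (gproj H) a) = res k (gpoint y) (nm k (gproj H) a).
  by apply: res_ext => x; apply: val_inj; rewrite /= rcoset1.
rewrite res_gpoint_nm.
rewrite (eq_bigr (fun=> a)) => [|x /eqP /(congr1 val) /=]; last first.
  rewrite rcoset1 => Hx; rewrite res_gfree_gpoint a_inv //.
  by rewrite -Hx rcoset_refl.
rewrite (eq_bigl (mem H)) ?prodr_const // => x.
rewrite -val_eqE /= rcoset1; apply/eqP/idP => [<-|]; first exact: rcoset_refl.
exact: rcoset_id.
Qed.

Theorem proposition4p3 (p n : nat) (p_prime : prime p)
  (gT : finGroupType) (cycG : cyclic [set: gT])
  (cardG : #|[set: gT]| = (p ^ n)%N)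
  (k : tambara gT) (clar_k : clarified k) (char_k : has_char (bottom k) p) :
  is_field (bottom k) /\
  forall (s : nat) (H : {group gT}), (s <= n)%N -> #|H| = (p ^ s)%N ->
    injective (res k (gproj H)) /\
    intermediate_field
      (fun x : bottom k =>
         exists2 a : bottom k, ginvariant a & x = iter n (frobenius p) a)
      (fun x : bottom k => exists a : k (gcosets H), x = res k (gproj H) a).
Proof.
have [k_fl k_clar] := clar_k.
have k_nz := has_char_nonzero p_prime char_k.
have inv_unit := field_like_invariant_unit k_fl.
have k_field : is_field (bottom k).
  have [//|k_sep] := field_or_coind k_nz
    (field_like_reduced p_prime k_fl char_k) inv_unit.
  by case: k_clar.
have act_inv (x y : bottom k) g : x * y = 1 ->
    gring_act (bottom k) x g = x -> gring_act (bottom k) y g = y.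
  move=> xy xg; rewrite -[LHS]mul1r -xy mulrAC -[X in X * _ * _]xg.
  by rewrite -(gring_actM (bottom k) g).2 xy (gring_actM (bottom k) g).1 mul1r.
split=> // s H le_sn cardH; split; first exact: field_like_res_inj.
have [k_act1 k_actM] := (fun g => (gring_actM (bottom k) g).1,
                         fun g => (gring_actM (bottom k) g).2).
split.
- split.
  + exists 1; first by move=> g; rewrite k_act1.
    by rewrite iter_frobenius expr1n.
  + move=> _ _ [a a_inv ->] [b b_inv ->]; exists (a - b).
      by move=> g; rewrite (gring_actB (bottom k) g) a_inv b_inv.
    by rewrite (iter_frobeniusB p_prime char_k).
  + move=> _ _ [a a_inv ->] [b b_inv ->]; exists (a * b).
      by move=> g; rewrite k_actM a_inv b_inv.
    by rewrite !iter_frobenius exprMn.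
  + move=> _ [a a_inv ->] a_nz.
    have [|b ab] := inv_unit a a_inv.
      apply: contraNneq a_nz => ->.
      by rewrite iter_frobenius expr0n expn_eq0 -leqn0 leqNgt prime_gt0.
    exists (iter n (frobenius p) b); first by exists b => // g; exact: act_inv (a_inv g).
    by rewrite !iter_frobenius -exprMn ab expr1n.
- split.
  + by exists 1; rewrite rmorph1.
  + by move=> _ _ [a ->] [b ->]; exists (a - b); rewrite rmorphB.
  + by move=> _ _ [a ->] [b ->]; exists (a * b); rewrite rmorphM.
  + move=> _ [a ->] a_nz; have [y xy] := k_field.2 _ a_nz.
    exists y => //.
    (* With x the restriction of a: y = x ^ (|H| - 1) * y ^ |H|, and y ^ |H|
       is the restriction of the norm of y. *)
    exists (a ^+ #|H|.-1 * nm k (gproj H) y).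
    rewrite rmorphM rmorphXn res_nm_gproj => [|h Hh]; last first.
      exact: act_inv xy (gproj_inv _ Hh).
    by rewrite -[in RHS](prednK (cardG_gt0 H)) exprSr mulrA -exprMn xy expr1n mul1r.
- move=> _ [a a_inv ->]; exists (nm k (gproj H) (a ^+ (p ^ (n - s)))).
  rewrite res_nm_gproj => [|h _]; last first.
    rewrite -[in RHS](a_inv h).
    exact: (rmorphXn (@gring_actr gT (bottom k) h)).
  by rewrite iter_frobenius cardH -exprM -expnD subnK.
Qed.
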